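(* Let $n\ge 1$ and $0\le k$. The set of unit Fubini rankings of length $n$ having exactly $n-k$ distinct values (ranks) is in bijection with the set of Boolean intervals of rank $k$ in the right weak order $W(\mathfrak{S}_n)$.
   Context: $[n]=\{1,\ldots,n\}$. Parking process: a tuple $\alpha=(a_1,\ldots,a_n)\in[n]^n$ encodes preferences of cars $1,\ldots,n$ arriving in this order at a one-way street with spots $1,\ldots,n$; car $i$ parks in spot $a_i$ if free, otherwise in the first free spot after $a_i$, if any. $\alpha$ is a parking function if all cars park (equivalently its weakly increasing rearrangement $a'_1\le\cdots\le a'_n$ satisfies $a'_i\le i$ for all $i$). A unit interval parking function is a parking function in which every car $i$ parks in spot $a_i$ or $a_i+1$. A Fubini ranking of length $n$ is a tuple $(r_1,\ldots,r_n)\in[n]^n$ recording a ranking of $n$ competitors with ties allowed, where if $m$ competitors tie at rank $r$ then ranks $r+1,\ldots,r+m-1$ are not used; formally, $r_i=1+|\{j:r_j<r_i\}|$ for every $i$. A unit Fubini ranking is a tuple that is both a Fubini ranking and a unit interval parking function. The right weak order $W(\mathfrak{S}_n)$ is the partial order on $\mathfrak{S}_n$ with cover relations $\tau\lessdot\tau s_i$ whenever $\tau(i)<\tau(i+1)$, where $s_i=(i,i+1)$. An interval $[v,w]=\{u:v\le u\le w\}$ is a Boolean interval of rank $k$ if it is isomorphic as a poset to the lattice of subsets of a $k$-element set; $[\pi,\pi]$ has rank $0$. *)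

(* Defs.v *)
From mathcomp Require Import all_boot all_fingroup.

Set Implicit Arguments.
Unset Strict Implicit.
Unset Printing Implicit Defensive.

(* The set [n] = {1, ..., n} of spots, preferences and ranks is represented   *)
(* by 'I_n = {0, ..., n-1}: the element i of 'I_n stands for i + 1.           *)

Section Parking.
Variable n : nat.

(* At most one s satisfies the condition, so [pick] makes no arbitrary choice;*)
(* None means that the car cannot park.                                       *)
Definition first_free (occ : {set 'I_n}) (a : 'I_n) : option 'I_n :=
  [pick s : 'I_n | [&& a <= s, s \notin occ
                     & [forall t : 'I_n, (a <= t < s) ==> (t \in occ)]]].

Fixpoint park (occ : {set 'I_n}) (prefs : seq 'I_n) : seq (option 'I_n) :=
  if prefs is a :: prefs' then
    let p := first_free occ a in
    p :: park (if p is Some s then s |: occ else occ) prefs'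
  else [::].

Definition spot (a : n.-tuple 'I_n) (i : 'I_n) : option 'I_n :=
  nth None (park set0 a) i.

Definition parking_function (a : n.-tuple 'I_n) : bool :=
  [forall i : 'I_n, isSome (spot a i)].

Definition unit_interval_pf (a : n.-tuple 'I_n) : bool :=
  parking_function a &&
  [forall i : 'I_n,
     if spot a i is Some s
     then (s == tnth a i :> nat) || (s == (tnth a i).+1 :> nat)
     else false].

(* In the 1-based convention this reads r_i = 1 + #|{j : r_j < r_i}|.         *)
Definition fubini_ranking (r : n.-tuple 'I_n) : bool :=
  [forall i : 'I_n,
     tnth r i == #|[set j : 'I_n | tnth r j < tnth r i]| :> nat].

Definition unit_fubini_ranking (r : n.-tuple 'I_n) : bool :=
  fubini_ranking r && unit_interval_pf r.

Definition num_ranks (r : n.-tuple 'I_n) : nat := size (undup r).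

End Parking.

Section WeakOrder.
Variable n : nat.

(* In MathComp (s * t) x = t (s x), so the permutation written tau s_i with   *)
(* functions composed from right to left is tperm i j * tau (with j = i + 1). *)
Definition weak_cover (tau u : 'S_n) : bool :=
  [exists i : 'I_n, [exists j : 'I_n,
     [&& j == i.+1 :> nat, tau i < tau j & u == (tperm i j * tau)%g]]].

Definition weak_le (v w : 'S_n) : bool := connect weak_cover v w.

Definition weak_interval (v w : 'S_n) : {set 'S_n} :=
  [set u | weak_le v u && weak_le u w].

Definition iso_boolean_lattice (k : nat) (I : {set 'S_n}) : bool :=
  [exists f : {ffun {set 'I_k} -> 'S_n},
     [&& injectiveb f,
         [set f A | A : {set 'I_k}] == I
       & [forall A : {set 'I_k}, [forall B : {set 'I_k},
            (A \subset B) == weak_le (f A) (f B)]]]].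

Definition boolean_interval (k : nat) (I : {set 'S_n}) : bool :=
  [exists v : 'S_n, [exists w : 'S_n,
     [&& weak_le v w, I == weak_interval v w & iso_boolean_lattice k I]]].

End WeakOrder.

(* "Exactly n - k ranks" is written as num_ranks r + k = n, which avoids the  *)
(* truncated subtraction of nat when k > n.                                   *)
Definition unit_fubini_with (n k : nat) : Type :=
  {r : n.-tuple 'I_n | unit_fubini_ranking r && (num_ranks r + k == n)}.

Definition boolean_intervals (n k : nat) : Type :=
  {I : {set 'S_n} | boolean_interval k I}.

(* Main.v *)
(* The right weak order is inclusion of the inversion sets, taken on values.
   A Fubini ranking is a unit interval parking function exactly when no three
   competitors tie. List the competitors by increasing rank: breaking every tie
   in increasing order gives a permutation v, breaking every tie in decreasing
   order gives a permutation w, and the elements of [v, w] are obtained by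
   choosing freely how to break each of the k ties, so [v, w] is Boolean of
   rank k. Conversely, in a Boolean interval [v, w] let J be the set of ascents
   i of v with v s_i <= w. Distributivity forbids two consecutive elements in
   J, so merging the positions i and i+1 for i in J yields a unit Fubini
   ranking, and w is recovered because every element of [v, w] other than v
   lies above some v s_i with i in J. *)

Require Import Defs.
From mathcomp Require Import all_boot all_fingroup.
From mathcomp Require Import zify.

Set Implicit Arguments.
Unset Strict Implicit.
Unset Printing Implicit Defensive.

(** * Right weak order as inclusion of inversion sets *)

Section InversionOrder.
Variable n : nat.
Implicit Types (u v w p q : 'S_n) (i j x y z : 'I_n).

Lemma card_ord_below (m : nat) : m <= n -> #|[set j : 'I_n | j < m]| = m.
Proof.
move=> le_mn; have widen_inj : injective (widen_ord le_mn).
  by move=> i j /(congr1 val) /= /val_inj.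
rewrite -[RHS]card_ord -(card_imset _ widen_inj).
apply: eq_card => j; rewrite inE; apply/idP/imsetP => [lt_jm | [i _ ->]] /=.
  by exists (Ordinal lt_jm) => //; apply: val_inj.
exact: ltn_ord.
Qed.

Lemma card_perm_below p (m : nat) : m <= n -> #|[set y | p y < m]| = m.
Proof.
move=> le_mn; rewrite -[RHS](card_ord_below le_mn).
rewrite -(card_imset _ (@perm_inj _ p)); apply: eq_card => j; rewrite inE.
apply/imsetP/idP => [[y]|lt_j]; first by rewrite inE => lt_y ->.
by exists ((p^-1)%g j); rewrite ?inE permKV.
Qed.

(** Inversions are recorded as pairs of values: the larger value [y] stands to the left of [x] in
    the one-line notation of [u]. *)
Definition inv u x y := (x < y) && ((u^-1)%g y < (u^-1)%g x).

(** The position of [x] is the number of values standing to its left, and the inversions decide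
    which values those are. *)
Lemma inv_inj u v : (forall x y, x < y -> inv u x y = inv v x y) -> u = v.
Proof.
move=> eq_inv; apply: invg_inj; apply/permP => x; apply: val_inj => /=.
rewrite -[LHS](card_perm_below u^-1%g (ltnW (ltn_ord _))).
rewrite -[RHS](card_perm_below v^-1%g (ltnW (ltn_ord _))); apply: eq_card => y; rewrite !inE.
have flip (s : 'S_n) (a b : 'I_n) : a < b -> (s a < s b) = ~~ (s b < s a).
  move=> ab; case: ltngtP => // /val_inj/perm_inj eab; by rewrite eab ltnn in ab.
case: (ltngtP x y) => [lt_xy|lt_yx|/val_inj->]; last by rewrite !ltnn.
  by have := eq_inv _ _ lt_xy; rewrite /inv lt_xy.
have := eq_inv _ _ lt_yx; rewrite /inv lt_yx /= => e.
by rewrite [LHS](flip _ y x) // [RHS](flip _ y x) // e.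
Qed.

Definition inv_sub v w := forall x y, inv v x y -> inv w x y.

Lemma inv_sub_anti v w : inv_sub v w -> inv_sub w v -> v = w.
Proof.
by move=> vw wv; apply: inv_inj => x y _; apply/idP/idP; [apply: vw|apply: wv].
Qed.

(** Exchanging the entries at two adjacent positions alters the relative order of no other pair of
    values. *)
Lemma inv_swap v i j x y : j = i.+1 :> nat -> v i < v j ->
  inv (tperm i j * v)%g x y = inv v x y || (x == v i) && (y == v j).
Proof.
move=> ji lt_v; rewrite /inv invMg tpermV !permM.
rewrite -{1 3 5}(permKV v x) -{1 3 5}(permKV v y) !(inj_eq perm_inj).
move: (v^-1 x)%g (v^-1 y)%g => a b; rewrite -!val_eqE.
case: (tpermP i j a) => [->|->|/eqP + /eqP +];
  case: (tpermP i j b) => [->|->|/eqP + /eqP +]; rewrite -?val_eqE /=; lia.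
Qed.

Lemma cover_inv v w : weak_cover v w -> inv_sub v w.
Proof.
move=> /existsP[i /existsP[j /and3P[/eqP ji lt_v /eqP->]]] x y vxy.
by rewrite inv_swap // vxy.
Qed.

Lemma weak_le_inv_sub v w : weak_le v w -> inv_sub v w.
Proof.
case/connectP => s; elim: s v => [|u s IH] v /=; first by move=> _ ->.
case/andP => vu us ew x y vxy; apply: (IH u us ew); exact: cover_inv vu _ _ vxy.
Qed.

(* Otherwise [w^-1 v] would be increasing on consecutive positions, hence the
   identity. *)
Lemma ascent_below v w : inv_sub v w -> v <> w ->
  exists i j : 'I_n, [/\ j = i.+1 :> nat, v i < v j & inv w (v i) (v j)].
Proof.
move=> vw neq_vw.
have [/existsP[i /existsP[j /and3P[/eqP ji lt_v w_ij]]]|no_asc] :=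
  boolP [exists i : 'I_n, [exists j : 'I_n, [&& j == i.+1 :> nat, v i < v j & inv w (v i) (v j)]]].
  by exists i, j.
case: neq_vw; apply: inv_sub_anti => // x y.
have step (i j : 'I_n) : j = i.+1 :> nat -> (w^-1 (v i) < w^-1 (v j))%g.
  move=> ji; have neq_ij : i != j by apply: contra_eqN ji => /eqP->; lia.
  have neq_v : (v i != v j :> nat) by rewrite val_eqE (inj_eq perm_inj).
  have neq_w : (w^-1 (v i) != w^-1 (v j) :> nat)%g by rewrite val_eqE !(inj_eq perm_inj).
  case: (ltngtP (v i) (v j)) neq_v => // lt_v _.
    have := existsPn no_asc i => /existsPn/(_ j); rewrite ji eqxx lt_v /inv lt_v /=; lia.
  by have /andP[] : inv w (v j) (v i) by apply: vw; rewrite /inv lt_v !permK ji /=.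
have mono m (i j : 'I_n) : j = m + i.+1 :> nat -> (w^-1 (v i) < w^-1 (v j))%g.
  elim: m j => [|m IH] j ej; first exact: step.
  have ltj' : j.-1 < n by have := ltn_ord j; lia.
  apply: ltn_trans (IH (Ordinal ltj') _) (step _ _ _) => /=; lia.
rewrite /inv => /andP[-> lt_w] /=; rewrite ltnNge leq_eqVlt; apply/negP => /orP[/eqP|] e.
  by move/val_inj/perm_inj: e lt_w => ->; rewrite ltnn.
(* If [x] stood left of [y] in [v], chaining the steps over the positions between them would keep
   [x] left of [y] in [w], against [lt_w]. *)
have := mono ((v^-1 y) - (v^-1 x).+1)%g (v^-1 x)%g (v^-1 y)%g.
rewrite !permKV; lia.
Qed.

Lemma swap_inv_sub v w i j : j = i.+1 :> nat -> v i < v j -> inv_sub v w ->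
  inv w (v i) (v j) -> inv_sub (tperm i j * v)%g w.
Proof.
by move=> ji lt_v vw w_ij x y; rewrite inv_swap // => /orP[/vw//|/andP[/eqP-> /eqP->]].
Qed.

(** For the converse, [ascent_below] provides a cover of [v] still below [w]; it has more inversions
    than [v], so induction on the number of missing inversions builds the chain. *)
Lemma weak_leP v w : weak_le v w <-> inv_sub v w.
Proof.
split=> [|vw]; first exact: weak_le_inv_sub.
pose Inv u := [set xy : 'I_n * 'I_n | inv u xy.1 xy.2].
have [m] := ubnP (#|Inv w| - #|Inv v|); elim: m => // m IH in v vw *.
move=> le_m; have [->|/eqP neq_vw] := eqVneq v w; first exact: connect0.
have [i [j [ji lt_v w_ij]]] := ascent_below vw neq_vw.
set v' := (tperm i j * v)%g.
have v'w : inv_sub v' w by apply: swap_inv_sub.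
have vv' : weak_cover v v'.
  by apply/existsP; exists i; apply/existsP; exists j; rewrite ji lt_v !eqxx.
apply: connect_trans (connect1 vv') (IH _ v'w _).
suff: #|Inv v| < #|Inv v'| <= #|Inv w| by lia.
apply/andP; split; last by apply: subset_leq_card; apply/subsetP => -[x y]; rewrite !inE; apply: v'w.
apply: proper_card; apply/properP; split.
  by apply/subsetP => -[x y]; rewrite !inE; apply: cover_inv.
by exists (v i, v j); rewrite !inE /= ?inv_swap ?eqxx ?orbT // /inv lt_v !permK ji /=; lia.
Qed.

Lemma mem_weak_interval v w u :
  reflect (inv_sub v u /\ inv_sub u w) (u \in weak_interval v w).
Proof.
rewrite inE; apply: (iffP andP) => -[vu uw]; split; exact/weak_leP.
Qed.

Lemma weak_interval_inj v w v' w' : inv_sub v w -> inv_sub v' w' ->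
  weak_interval v w = weak_interval v' w' -> v = v' /\ w = w'.
Proof.
move=> vw vw' e.
have mem s t : inv_sub s t -> s \in weak_interval s t /\ t \in weak_interval s t.
  by move=> st; split; apply/mem_weak_interval; split.
have [v_in w_in] := mem _ _ vw; have [v'_in w'_in] := mem _ _ vw'.
rewrite e in v_in w_in; rewrite -e in v'_in w'_in.
move: v_in w_in v'_in w'_in => /mem_weak_interval[v1 v2] /mem_weak_interval[w1 w2].
move=> /mem_weak_interval[v3 v4] /mem_weak_interval[w3 w4].
by split; apply: inv_sub_anti.
Qed.

End InversionOrder.

(** * Permutations obtained by breaking ties, and the Boolean interval they form *)

Section TieOrder.
Variable n : nat.
Implicit Types (r : 'I_n -> 'I_n) (A B : {set 'I_n}) (x y z : 'I_n).

(* Ranks in [A] are those whose tied competitors are listed in decreasing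
   order. *)
Definition before r A x y :=
  (r x < r y) || (r x == r y) && (if r x \in A then y < x else x < y).

Lemma before_irr r A x : before r A x x = false.
Proof. by rewrite /before ltnn eqxx; case: ifP; rewrite ltnn. Qed.

Lemma before_trans r A : transitive (before r A).
Proof.
move=> y x z; rewrite /before => /orP[xy|/andP[/eqP->]].
  by case/orP => [yz|/andP[/eqP<-]]; rewrite ?xy // (ltn_trans xy yz).
case: ifP => rA xy /orP[->//|/andP[->]] /=; last by move/(ltn_trans xy) => ->; rewrite orbT.
by move=> zy; rewrite (ltn_trans zy xy) orbT.
Qed.

Lemma before_total r A x y : x != y -> before r A x y || before r A y x.
Proof.
rewrite /before -val_eqE => neq_xy.
case: (ltngtP (r x) (r y)) => [||/val_inj->] /=; rewrite ?orbT ?eqxx //=.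
by case: ifP => _; case: ltngtP neq_xy.
Qed.

Lemma card_before_lt r A x y : before r A x y ->
  #|[set z | before r A z x]| < #|[set z | before r A z y]|.
Proof.
move=> xy; apply: proper_card; apply/properP; split.
  by apply/subsetP => z; rewrite !inE => /before_trans; apply.
by exists x; rewrite !inE ?before_irr.
Qed.

Lemma card_before r A x : #|[set z | before r A z x]| < n.
Proof.
rewrite -[n in _ < n]card_ord; apply: proper_card; apply/properP; split.
  exact/subsetP.
by exists x; rewrite // inE before_irr.
Qed.

Definition tie_index r A x : 'I_n := Ordinal (card_before r A x).

Lemma tie_index_lt r A x y : (tie_index r A x < tie_index r A y) = before r A x y.
Proof.
apply/idP/idP => [|/card_before_lt//]; apply: contraTT => nxy.
have [->|/(before_total r A)] := eqVneq x y; first by rewrite ltnn.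
by rewrite (negPf nxy) -leqNgt => /card_before_lt/ltnW.
Qed.

Lemma tie_index_inj r A : injective (tie_index r A).
Proof.
move=> x y e; apply/eqP; apply: contraT => /(before_total r A).
by rewrite -!tie_index_lt e ltnn.
Qed.

(** The inverse appears because [tie_index] sends a competitor to a position, whereas the one-line
    notation lists the competitors by position. *)
Definition tie_perm r A : 'S_n := (perm (@tie_index_inj r A))^-1%g.

Lemma tie_permV r A x : (tie_perm r A)^-1%g x = tie_index r A x.
Proof. by rewrite invgK permE. Qed.

Lemma inv_tie_perm r A x y :
  inv (tie_perm r A) x y = (x < y) && ((r y < r x) || (r x == r y) && (r x \in A)).
Proof.
rewrite /inv !tie_permV tie_index_lt /before eq_sym.
case: (ltnP x y) => //= xy; case: eqVneq => [->|_]; rewrite ?andbF //=.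
by rewrite ltnn; case: ifP => _; rewrite ?xy // ltnNge ltnW.
Qed.

Definition ties_at_most_2 r := forall x y z, r x = r y -> r y = r z ->
  [|| x == y, y == z | x == z].

Definition tied_ranks r := [set c : 'I_n | [exists x : 'I_n, exists y : 'I_n, [&& x < y, r x == c & r y == c]]].

Definition tie_interval r : {set 'S_n} :=
  weak_interval (tie_perm r set0) (tie_perm r setT).

Lemma tie_perm_sub r A B : A \subset B -> inv_sub (tie_perm r A) (tie_perm r B).
Proof.
move=> /subsetP AB x y; rewrite !inv_tie_perm => /andP[-> /=].
by case/orP => [->//|/andP[-> /AB->]]; rewrite orbT.
Qed.

(** A rank in [A] carries a tied pair, and that pair is inverted in [tie_perm r B] exactly when the
    rank lies in [B]. *)
Lemma tie_perm_subP r A B : A \subset tied_ranks r ->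
  inv_sub (tie_perm r A) (tie_perm r B) <-> A \subset B.
Proof.
move=> /subsetP AD; split; last exact: tie_perm_sub.
move=> sub; apply/subsetP => c cA; have := AD c cA.
rewrite inE => /existsP[x /existsP[y /and3P[xy /eqP rx /eqP ry]]].
have := sub x y; rewrite !inv_tie_perm xy rx ry ltnn eqxx /= cA.
by apply.
Qed.

(** The two ends of the interval agree on competitors of different rank, so [u] is free only on
    ties. Each rank has at most one tied pair, so it suffices to record in [A] the ranks whose pair
    [u] inverts. *)
Lemma tie_intervalP r u : ties_at_most_2 r -> u \in tie_interval r ->
  exists2 A : {set 'I_n}, A \subset tied_ranks r & u = tie_perm r A.
Proof.
move=> le2 /mem_weak_interval[vu uw].
pose A := [set c : 'I_n | [exists x : 'I_n, exists y : 'I_n, [&& inv u x y, r x == c & r y == c]]].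
exists A.
  apply/subsetP => c; rewrite !inE => /existsP[x /existsP[y /and3P[]]].
  case/andP => xy _ rx ry; apply/existsP; exists x; apply/existsP; exists y.
  by rewrite xy rx.
apply: inv_inj => x y xy; rewrite inv_tie_perm xy /=.
case: (ltngtP (r x) (r y)) => [lt_r|lt_r|/val_inj e_r] /=.
- have neq_r : (r x == r y) = false by rewrite -val_eqE (ltn_eqF lt_r).
  rewrite neq_r; apply/negP => /uw.
  by rewrite inv_tie_perm neq_r orbF => /andP[_ /(ltn_trans lt_r)]; rewrite ltnn.
- by apply: vu; rewrite inv_tie_perm xy lt_r.
rewrite e_r eqxx inE; apply/idP/existsP => [uxy|[x' /existsP[y' /and3P[ux'y' /eqP rx' /eqP ry']]]].
  by exists x; apply/existsP; exists y; rewrite uxy e_r !eqxx.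
have [lt' _] := andP ux'y'.
suff [-> ->] : x = x' /\ y = y' by [].
have := le2 x y x'; have := le2 x y y'; have := le2 x x' y'.
rewrite e_r rx' ry' => /(_ erefl erefl) + /(_ erefl erefl) + /(_ erefl erefl).
by rewrite -!val_eqE /= => h1 h2 h3; split; apply: val_inj => /=; lia.
Qed.

Lemma tie_interval_sub r : inv_sub (tie_perm r set0) (tie_perm r setT).
Proof. exact/tie_perm_sub/sub0set. Qed.

Lemma boolean_tie_interval r : ties_at_most_2 r ->
  boolean_interval #|tied_ranks r| (tie_interval r).
Proof.
move=> le2; apply/existsP; exists (tie_perm r set0); apply/existsP.
exists (tie_perm r setT); apply/and3P; split => //.
  exact/weak_leP/tie_interval_sub.
(* [enum_val] numbers the tied ranks, so [ranks] identifies the subsets of the index set with those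
   of [D]. *)
pose D := tied_ranks r; pose ranks (A : {set 'I_#|D|}) := [set enum_val i | i in A].
have ranksD (A : {set 'I_#|D|}) : ranks A \subset D by apply/subsetP => _ /imsetP[i _ ->]; apply: enum_valP.
have order (A B : {set 'I_#|D|}) :
    (A \subset B) = weak_le (tie_perm r (ranks A)) (tie_perm r (ranks B)).
  transitivity (ranks A \subset ranks B).
    apply/idP/idP => [|/subsetP AB]; first exact: imsetS.
    apply/subsetP => i /(imset_f (@enum_val _ D))/AB.
    by rewrite mem_imset //; apply: enum_val_inj.
  apply/idP/idP => [AB|/weak_leP AB]; first exact/weak_leP/tie_perm_sub.
  exact/(tie_perm_subP _ (ranksD A)).
apply/existsP; exists [ffun A => tie_perm r (ranks A)]; apply/and3P; split.
- apply/injectiveP => A B; rewrite !ffunE => e; apply/eqP; rewrite eqEsubset.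
  by rewrite !order e andbb; apply: connect0.
- apply/eqP/setP => u; apply/imsetP/idP => [[A _ ->]|].
    rewrite ffunE; apply/mem_weak_interval.
    by split; apply: tie_perm_sub; [apply: sub0set|apply: subsetT].
  move=> /(tie_intervalP le2)[A AD ->].
  exists [set i | enum_val i \in A] => //; rewrite ffunE; congr tie_perm.
  apply/setP => c; apply/idP/imsetP => [cA|[i]]; last by rewrite inE => iA ->.
  exists (enum_rank_in (subsetP AD c cA) c); rewrite ?inE enum_rankK_in //; exact: (subsetP AD).
by apply/forallP => A; apply/forallP => B; rewrite !ffunE order.
Qed.

Definition is_ranking r := forall x, r x = #|[set y | r y < r x]| :> nat.

(** Competitor [y] ranks strictly ahead of [x] exactly when [y] precedes [x] under both ways of
    breaking ties. The ends of the interval thus determine all strict comparisons, and counting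
    these gives the ranks. *)
Lemma tie_interval_inj r r' : is_ranking r -> is_ranking r' ->
  tie_interval r = tie_interval r' -> r =1 r'.
Proof.
move=> Fr Fr' /(weak_interval_inj (@tie_interval_sub r) (@tie_interval_sub r')) [ev ew] x.
have lt_r (s : 'I_n -> 'I_n) (y : 'I_n) : (s y < s x) = before s set0 y x && before s setT y x.
  by rewrite /before !inE -val_eqE /=; lia.
apply: val_inj; rewrite /= Fr Fr'; apply: eq_card => y; rewrite !inE !lt_r.
by rewrite -!tie_index_lt -!tie_permV ev ew.
Qed.

(** Let [D] hold the smaller member of each tied pair. On [D] the map [r] is injective with image
    the tied ranks; on the complement it is injective with image all ranks. The two cardinalities
    add up to [n]. *)
Lemma card_tied_ranks r : ties_at_most_2 r ->
  #|[set r x | x in 'I_n]| + #|tied_ranks r| = n.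
Proof.
move=> le2; pose D := [set x : 'I_n | [exists y : 'I_n, (x < y) && (r x == r y)]].
have -> : tied_ranks r = r @: D.
  apply/setP => c; rewrite inE; apply/existsP/imsetP.
    move=> [x /existsP[y /and3P[xy /eqP rx /eqP ry]]]; exists x => //.
    by rewrite inE; apply/existsP; exists y; rewrite xy rx ry /=.
  move=> [x]; rewrite inE => /existsP[y /andP[xy /eqP rxy]] ->.
  by exists x; apply/existsP; exists y; rewrite xy rxy eqxx.
have -> : [set r x | x in 'I_n] = r @: ~: D.
  apply/eqP; rewrite eqEsubset; apply/andP; split; last exact/imsetS/subsetP.
  apply/subsetP => _ /imsetP[x _ ->].
  have [xD|xD] := boolP (x \in D); last by rewrite imset_f // in_setC.
  move: xD; rewrite inE => /existsP[y /andP[xy /eqP rxy]].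
  rewrite rxy imset_f // !inE; apply/negP => /existsP[z /andP[yz /eqP ryz]].
  have := le2 x y z rxy ryz; rewrite -!val_eqE /=; lia.
rewrite !card_in_imset; first by rewrite addnC cardsC card_ord.
  move=> x y; rewrite !inE => /existsP[x' /andP[xx' /eqP rx]] /existsP[y' /andP[yy' /eqP ry]] e.
  have := le2 x y y' e ry; have := le2 y x x' (esym e) rx.
  by rewrite -!val_eqE /= => h1 h2; apply: val_inj => /=; lia.
move=> x y; rewrite !inE => /existsPn xD /existsPn yD e; apply: val_inj => /=.
have := xD y; have := yD x; rewrite e eqxx !andbT; lia.
Qed.

End TieOrder.

(** * Unit interval parking functions among Fubini rankings *)

Section UnitParking.
Variable n : nat.
Implicit Types (occ : {set 'I_n}) (prefs : seq 'I_n) (a s t : 'I_n).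

Lemma first_free_notin occ a s : first_free occ a = Some s -> s \notin occ.
Proof. by rewrite /first_free; case: pickP => // s' /and3P[_ ? _] [<-]. Qed.

Lemma first_free_eq occ a s : a <= s -> s \notin occ ->
  (forall t, a <= t < s -> t \in occ) -> first_free occ a = Some s.
Proof.
move=> le_as sNocc between; rewrite /first_free; case: pickP => [s'|/(_ s)].
  case/and3P => le_as' s'Nocc /forallP between'; congr Some; apply: val_inj.
  case: (ltngtP s' s) => // [lt_s's|lt_ss'].
    by rewrite between ?le_as' in s'Nocc.
  by have := between' s; rewrite le_as lt_ss' (negPf sNocc).
rewrite le_as sNocc /= => /negbT/forallPn[t]; by rewrite negb_imply => /andP[/between->].
Qed.

Lemma park_notin occ prefs i s : nth None (park occ prefs) i = Some s -> s \notin occ.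
Proof.
elim: prefs occ i => [|a prefs IH] occ [|i] //=; first exact: first_free_notin.
move/IH; case: (first_free occ a) => [s'|] //.
by rewrite !inE => /norP[].
Qed.

Lemma park_inj occ prefs i j s : i < j ->
  nth None (park occ prefs) i = Some s -> nth None (park occ prefs) j <> Some s.
Proof.
elim: prefs occ i j => [|a prefs IH] occ [|i] [|j] //=; last by move=> ij s_i; apply: IH s_i.
by move=> _ -> /park_notin; rewrite setU11.
Qed.

Definition occupied occ prefs : {set 'I_n} :=
  foldl (fun occ a => if first_free occ a is Some s then s |: occ else occ) occ prefs.

Lemma nth_park occ prefs i a0 : i < size prefs ->
  nth None (park occ prefs) i = first_free (occupied occ (take i prefs)) (nth a0 prefs i).
Proof. by elim: prefs occ i => [|a prefs IH] occ [|i] //= /IH ->. Qed.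

Lemma spotE (r : n.-tuple 'I_n) (i : 'I_n) :
  spot r i = first_free (occupied set0 (take i r)) (tnth r i).
Proof. by rewrite /spot (nth_park _ (tnth r i)) ?size_tuple // -tnth_nth. Qed.

(** Cars with the same preference share two admissible spots, and distinct cars park in distinct
    spots; three such cars do not fit. *)
Lemma unit_interval_ties (r : n.-tuple 'I_n) :
  unit_interval_pf r -> ties_at_most_2 (tnth r).
Proof.
move=> /andP[_ /forallP unit_r] x y z exy eyz.
have spot_neq (i j : 'I_n) s t : spot r i = Some s -> spot r j = Some t ->
    (i == j) || (s != t :> nat).
  move=> si tj; rewrite -val_eqE /=; case: ltngtP => //= ij; apply/eqP => /val_inj est.
    by apply: (park_inj ij si); rewrite est.
  by apply: (park_inj ij tj); rewrite -est.
have := unit_r x; have := unit_r y; have := unit_r z; rewrite exy eyz.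
case sz : (spot r z) => [c|//]; case sy : (spot r y) => [b|//].
case sx : (spot r x) => [a|//] hc hb ha.
have := spot_neq _ _ _ _ sx sy; have := spot_neq _ _ _ _ sy sz; have := spot_neq _ _ _ _ sx sz.
by case: (x == y); case: (y == z); case: (x == z) => //=; lia.
Qed.

Lemma tie_index_rank (r : 'I_n -> 'I_n) (x : 'I_n) : is_ranking r ->
  tie_index r set0 x = r x + #|[set y | (r y == r x) && (y < x)]| :> nat.
Proof.
move=> rk_r /=; rewrite [in RHS]rk_r -cardsUI [X in _ = _ + #|pred_of_set X|](_ : _ = set0).
  by rewrite cards0 addn0; apply: eq_card => y; rewrite /before !inE.
apply/setP => y; rewrite !inE; case: eqVneq => [->|]; rewrite ?ltnn ?andbF //.
Qed.

Lemma tie_index_first (r : 'I_n -> 'I_n) (x : 'I_n) : is_ranking r ->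
  (forall y, r y = r x -> ~~ (y < x)) -> tie_index r set0 x = r x.
Proof.
move=> rk_r first_x; apply: val_inj; rewrite [LHS](tie_index_rank _ rk_r).
rewrite (_ : [set y | _] = set0) ?cards0 ?addn0 //.
by apply/setP => y; rewrite !inE; apply/andP => -[/eqP/first_x/negPf->].
Qed.

Lemma tie_index_second (r : 'I_n -> 'I_n) (x y : 'I_n) : is_ranking r ->
  ties_at_most_2 r -> r y = r x -> y < x ->
  tie_index r set0 x = (r x).+1 :> nat /\ tie_index r set0 y = r x.
Proof.
move=> rk_r le2 ryx lt_yx; split.
  rewrite tie_index_rank // (_ : [set z | _] = [set y]) ?cards1 ?addn1 //.
  apply/setP => z; rewrite !inE; apply/andP/eqP => [[/eqP rzx lt_zx]|->]; last by rewrite ryx.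
  have := le2 y z x; rewrite ryx rzx => /(_ erefl erefl).
  by rewrite -!val_eqE /= => h; apply: val_inj => /=; lia.
rewrite -ryx; apply: tie_index_first => // z rzy; apply/negP => lt_zy.
have := le2 z y x rzy ryx; rewrite -!val_eqE /=; lia.
Qed.

(** If an earlier car ties with [x], it occupies the preferred spot [r x] and the target is the next
    spot; otherwise the target is [r x] itself. Injectivity of [tie_index] keeps the target free. *)
Lemma first_free_tie_index (r : 'I_n -> 'I_n) (x : 'I_n) : is_ranking r ->
  ties_at_most_2 r ->
  first_free [set tie_index r set0 y | y : 'I_n & y < x] (r x) =
    Some (tie_index r set0 x).
Proof.
move=> rk_r le2; apply: first_free_eq.
- by rewrite tie_index_rank // leq_addr.
- by apply/imsetP => -[y]; rewrite inE => lt_yx /tie_index_inj exy; rewrite exy ltnn in lt_yx.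
move=> t; have [/existsP[y /andP[/eqP ryx lt_yx]]|] :=
    boolP [exists y : 'I_n, (r y == r x) && (y < x)].
  have [-> ey] := tie_index_second rk_r le2 ryx lt_yx; rewrite ltnS -eqn_leq => /eqP/val_inj <-.
  by rewrite -ey imset_f // inE.
move=> /existsPn none; rewrite tie_index_first //; first by case: ltngtP.
by move=> y ryx; have := none y; rewrite ryx eqxx.
Qed.

Lemma occupied_tie_index (r : n.-tuple 'I_n) (m : nat) : m <= n ->
  is_ranking (tnth r) -> ties_at_most_2 (tnth r) ->
  occupied set0 (take m r) = [set tie_index (tnth r) set0 y | y : 'I_n & y < m].
Proof.
move=> + rk_r le2; elim: m => [_|m IH lt_mn].
  by rewrite take0; apply/esym/eqP; rewrite imset_eq0; apply/eqP/setP => y; rewrite !inE.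
rewrite (take_nth (tnth r (Ordinal lt_mn))) ?size_tuple // /occupied foldl_rcons.
rewrite -/(occupied set0 (take m r)) (IH (ltnW lt_mn)).
rewrite -[m in nth _ _ m]/(val (Ordinal lt_mn)) -tnth_nth.
rewrite (first_free_tie_index (Ordinal lt_mn)) //.
rewrite -imsetU1 (_ : _ |: _ = [set y : 'I_n | y < m.+1]) //; apply/setP => y; by rewrite !inE -val_eqE /= ltnS [RHS]leq_eqVlt.
Qed.

(** Every car parks at its position in the list that breaks ties in increasing order, which is its
    rank or the next spot. *)
Lemma unit_interval_of_ties (r : n.-tuple 'I_n) : is_ranking (tnth r) ->
  ties_at_most_2 (tnth r) -> unit_interval_pf r.
Proof.
move=> rk_r le2; have spot_r (x : 'I_n) : spot r x = Some (tie_index (tnth r) set0 x).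
  by rewrite spotE occupied_tie_index ?(ltnW (ltn_ord x)) // first_free_tie_index.
apply/andP; split; apply/forallP => x; rewrite spot_r //.
have [/existsP[y /andP[/eqP ryx lt_yx]]|] :=
    boolP [exists y : 'I_n, (tnth r y == tnth r x) && (y < x)].
  by have [-> _] := tie_index_second rk_r le2 ryx lt_yx; rewrite eqxx orbT.
move=> /existsPn none; rewrite tie_index_first ?eqxx // => y ryx.
by have := none y; rewrite ryx eqxx.
Qed.

Lemma unit_fubiniP (r : n.-tuple 'I_n) :
  reflect (is_ranking (tnth r) /\ ties_at_most_2 (tnth r)) (unit_fubini_ranking r).
Proof.
apply: (iffP andP) => [[/forallP rk_r unit_r]|[rk_r le2]]; split.
- by move=> x; apply/eqP/rk_r.
- exact: unit_interval_ties.
- by apply/forallP => x; apply/eqP/rk_r.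
- exact: unit_interval_of_ties.
Qed.

End UnitParking.

(** * From a Boolean interval to a ranking with ties of size at most two *)

Section BooleanIntervals.
Variable n : nat.
Implicit Types (u v w : 'S_n) (i j l x y z : 'I_n).

Lemma inv_trans u x y z : inv u x y -> inv u y z -> inv u x z.
Proof.
by move=> /andP[xy yx] /andP[yz zy]; rewrite /inv (ltn_trans xy yz) (ltn_trans zy yx).
Qed.

Lemma inv_perm u i j : inv u (u i) (u j) = (u i < u j) && (j < i).
Proof. by rewrite /inv !permK. Qed.

Section Structure.
Variables (k : nat) (f : {set 'I_k} -> 'S_n) (v w : 'S_n).
Hypothesis le_vw : inv_sub v w.
Hypothesis f_image : [set f A | A : {set 'I_k}] = weak_interval v w.
Hypothesis f_order : forall A B : {set 'I_k}, (A \subset B) = weak_le (f A) (f B).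

Lemma f_sub (A B : {set 'I_k}) : A \subset B <-> inv_sub (f A) (f B).
Proof. by rewrite f_order; apply: weak_leP. Qed.

Lemma f_between A : inv_sub v (f A) /\ inv_sub (f A) w.
Proof. by apply/mem_weak_interval; rewrite -f_image imset_f. Qed.

Lemma f_onto u : inv_sub v u -> inv_sub u w -> exists A, u = f A.
Proof.
move=> vu uw; have : u \in weak_interval v w by apply/mem_weak_interval.
by rewrite -f_image => /imsetP[A _ ->]; exists A.
Qed.

Lemma f_bottom : f set0 = v.
Proof.
have [A eA] := f_onto (fun _ _ => id) le_vw.
apply: inv_sub_anti; last exact: (f_between _).1.
by rewrite eA; apply/f_sub/sub0set.
Qed.

(* With s, t the two adjacent transpositions, put a = v s, b = v t, c = v s t.
   Any common upper bound of a and b is above c, while the meet of b and c is v,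
   so distributivity would give c <= a. *)
Lemma no_adjacent_inversions i j l : j = i.+1 :> nat -> l = j.+1 :> nat ->
  inv w (v i) (v j) -> inv w (v j) (v l) -> False.
Proof.
move=> ji lj w_ij w_jl; have w_il := inv_trans w_ij w_jl.
have [lt_ij _] := andP w_ij; have [lt_jl _] := andP w_jl; have lt_il := ltn_trans lt_ij lt_jl.
have neq_li : (i == l) = false by rewrite -val_eqE /=; lia.
have neq_lj : (j == l) = false by rewrite -val_eqE /=; lia.
pose a := (tperm i j * v)%g; pose b := (tperm j l * v)%g; pose c := (tperm j l * a)%g.
have a_j : a j = v i by rewrite permM tpermR.
have a_l : a l = v l by rewrite permM tpermD ?neq_li ?neq_lj.
have inv_a x y : inv a x y = inv v x y || (x == v i) && (y == v j) by exact: inv_swap.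
have inv_b x y : inv b x y = inv v x y || (x == v j) && (y == v l) by exact: inv_swap.
have inv_c x y : inv c x y = inv a x y || (x == v i) && (y == v l).
  by rewrite inv_swap ?a_j ?a_l.
have [A eA] : exists A, a = f A.
  apply: f_onto => x y; rewrite inv_a; first by move->.
  by case/orP => [/le_vw//|/andP[/eqP-> /eqP->]].
have [B eB] : exists B, b = f B.
  apply: f_onto => x y; rewrite inv_b; first by move->.
  by case/orP => [/le_vw//|/andP[/eqP-> /eqP->]].
have [C eC] : exists C, c = f C.
  apply: f_onto => x y; rewrite inv_c inv_a; first by move->.
  by case/orP => [/orP[/le_vw//|]|] /andP[/eqP-> /eqP->].
have C_AB : C \subset A :|: B.
  have Af : inv_sub a (f (A :|: B)) by rewrite eA; apply/f_sub/subsetUl.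
  have Bf : inv_sub b (f (A :|: B)) by rewrite eB; apply/f_sub/subsetUr.
  apply/f_sub; rewrite -eC => x y; rewrite inv_c => /orP[/Af//|/andP[/eqP-> /eqP->]].
  by apply: (@inv_trans _ _ (v j)); [apply: Af|apply: Bf]; rewrite ?inv_a ?inv_b !eqxx orbT.
have CB0 : C :&: B = set0.
  apply/eqP; rewrite -subset0; apply/f_sub; rewrite f_bottom => x y xy.
  have : inv c x y by move: xy; rewrite eC; move: x y; apply/f_sub/subsetIl.
  have : inv b x y by move: xy; rewrite eB; move: x y; apply/f_sub/subsetIr.
  rewrite inv_c inv_b inv_a => /orP[//|/andP[/eqP-> _]].
  have neq_v : (v j == v i) = false by rewrite (inj_eq perm_inj) -val_eqE /=; lia.
  by rewrite neq_v /= !orbF.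
have : inv_sub c a.
  rewrite eC eA; apply/f_sub/subsetP => s sC; have := subsetP C_AB s sC; rewrite inE => /orP[//|sB].
  by have : s \in C :&: B; [rewrite inE sC | rewrite CB0 inE].
move/(_ (v i) (v l)); rewrite inv_c inv_a inv_perm !eqxx orbT => /(_ isT).
rewrite (inj_eq perm_inj) [l == j]eq_sym neq_lj /=; lia.
Qed.

(** Membership in the set J of ascents of [v] whose swap stays below [w]. Indexing by [nat] lets
    neighbouring positions be named without bounds; the value is false when [a.+1] is not a
    position. *)
Definition descends (a : nat) : bool :=
  [exists i : 'I_n, exists j : 'I_n,
    [&& i == a :> nat, j == a.+1 :> nat & inv w (v i) (v j)]].

Lemma descendsP i j : j = i.+1 :> nat -> descends i = inv w (v i) (v j).
Proof.
move=> ji; apply/existsP/idP => [[i' /existsP[j' /and3P[/eqP ei /eqP ej]]]|w_ij].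
  have -> : i' = i by apply: val_inj.
  by have -> : j' = j by apply: val_inj; rewrite /= ej.
by exists i; apply/existsP; exists j; rewrite ji !eqxx.
Qed.

Lemma descends_sparse a : descends a -> ~~ descends a.+1.
Proof.
move=> /existsP[i /existsP[j /and3P[/eqP ei /eqP ej w_ij]]].
apply/negP => /existsP[j' /existsP[l /and3P[/eqP ej' /eqP el w_jl]]].
have ejj : j' = j by apply: val_inj; rewrite /= ej.
rewrite ejj in w_jl; apply: (@no_adjacent_inversions i j l) => //=; by rewrite ?el ej ?ei.
Qed.

(** The first position of the block containing [a], where [a] joins [a.-1] if the latter
    descends. *)
Definition merged (a : nat) : nat := a - ((0 < a) && descends a.-1).

Lemma merged_bounds a : merged a <= a <= (merged a).+1.
Proof. by rewrite /merged; case: (_ && descends _); lia. Qed.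

(** By [descends_sparse] a block has at most two positions, both sent to the first. So the positions
    in earlier blocks are those below [merged b], which is the counting condition of a Fubini
    ranking. *)
Lemma merged_lt a b : (merged a < merged b) = (a < merged b).
Proof.
have := @descends_sparse a.-1; have := @descends_sparse b.-1.
rewrite /merged; case: a b => [|a] [|b] //=; rewrite ?subn0 //.
have [->|neq_ab] := eqVneq a b; first by case: (descends b); lia.
have [->|neq_ab'] := eqVneq b a.+1; last by case: (descends a); case: (descends b); lia.
by case: (descends a) => [_ /(_ isT)/negPf->|_ _]; case: (descends a.+1); lia.
Qed.

Lemma merged_eq a b : a < b -> merged a = merged b -> b = a.+1 /\ descends a.
Proof.
move=> lt_ab e_ab; have := merged_bounds a; have := merged_bounds b => hb ha.
have eb : b = a.+1 by lia.
split=> //; move: e_ab ha; rewrite eb {2}/merged /=; case: (descends a) => //; lia.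
Qed.

Lemma merged_succ a : descends a -> merged a.+1 = merged a.
Proof.
move=> da; have : ~~ (merged a < merged a.+1) by rewrite merged_lt /merged /= da; lia.
have := merged_bounds a; rewrite /merged /= da; lia.
Qed.

Lemma merged_mono a b : a <= b -> merged a <= merged b.
Proof. by move=> le_ab; rewrite leqNgt merged_lt; have := merged_bounds a; lia. Qed.

Lemma merged_pos x : merged (v^-1 x)%g < n.
Proof. by have := merged_bounds (v^-1 x)%g; have := ltn_ord (v^-1 x)%g; lia. Qed.

Definition pos_rank : n.-tuple 'I_n := [tuple Ordinal (merged_pos x) | x < n].

Lemma tnth_pos_rank x : tnth pos_rank x = merged (v^-1 x)%g :> nat.
Proof. by rewrite tnth_mktuple. Qed.

Lemma pos_rank_ranking : is_ranking (tnth pos_rank).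
Proof.
move=> x; rewrite -[LHS](card_perm_below v^-1%g (ltnW (ltn_ord _))).
by apply: eq_card => y; rewrite !inE !tnth_pos_rank merged_lt.
Qed.

Lemma pos_rank_ties : ties_at_most_2 (tnth pos_rank).
Proof.
move=> x y z /(congr1 val) /= exy /(congr1 val) /= eyz; move: exy eyz.
have pos s t : (s == t) = (v^-1 s == v^-1 t :> nat)%g by rewrite val_eqE (inj_eq perm_inj).
rewrite !tnth_pos_rank !pos.
have := merged_bounds (v^-1 x)%g; have := merged_bounds (v^-1 y)%g.
have := merged_bounds (v^-1 z)%g; lia.
Qed.

(** Merged positions are adjacent and carry increasing values in [v], so breaking these ties in
    increasing order restores [v]. *)
Lemma tie_perm_bottom : tie_perm (tnth pos_rank) set0 = v.
Proof.
apply: inv_inj => x y lt_xy; rewrite inv_tie_perm inE andbF orbF /inv lt_xy !tnth_pos_rank /=.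
rewrite -{1}(permKV v x) -{1}(permKV v y) in lt_xy.
move: (v^-1 x)%g (v^-1 y)%g lt_xy => i j lt_ij.
apply/idP/idP => [|lt_ji]; first by rewrite merged_lt; have := merged_bounds i; lia.
rewrite ltn_neqAle merged_mono ?(ltnW lt_ji) // andbT; apply/eqP => e_ji.
have [ei] := merged_eq lt_ji e_ji; rewrite (descendsP ei) => /andP[]; lia.
Qed.

Lemma descent_tie_perm i j : j = i.+1 :> nat -> inv w (v i) (v j) ->
  inv (tie_perm (tnth pos_rank) setT) (v i) (v j).
Proof.
move=> ji w_ij; have [lt_ij _] := andP w_ij.
by rewrite inv_tie_perm lt_ij -val_eqE /= !tnth_pos_rank !permK ji merged_succ ?(descendsP ji) // eqxx inE orbT.
Qed.

(** An inversion of [w'] is either one of [v] or a merged pair, which [w] inverts; hence [w'] lies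
    below [w]. For equality, the set [B] representing [w'] is shown to contain every atom [s] of the
    Boolean lattice used by [w]. *)
Lemma tie_perm_top : tie_perm (tnth pos_rank) setT = w.
Proof.
set w' := tie_perm _ _.
have vw' : inv_sub v w' by rewrite -{1}tie_perm_bottom; apply: tie_interval_sub.
have w'w : inv_sub w' w.
  move=> x y; rewrite inv_tie_perm inE andbT -val_eqE /= !tnth_pos_rank => /andP[lt_xy].
  have := permKV v x; have := permKV v y; move: (v^-1 x)%g (v^-1 y)%g => i j ey ex.
  rewrite eq_sym orbC -leq_eqVlt => le_ji; rewrite -ex -ey in lt_xy *.
  case: (ltngtP i j) => [lt_ij|lt_ji|/val_inj e_ij]; last by rewrite e_ij ltnn in lt_xy.
    have [ji] : j = i.+1 :> nat /\ descends i.
      by apply: merged_eq => //; apply/eqP; rewrite eqn_leq le_ji merged_mono ?(ltnW lt_ij).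
    by rewrite (descendsP ji).
  by apply: le_vw; rewrite inv_perm lt_xy.
apply: inv_sub_anti => //; have [B eB] := f_onto vw' w'w.
have [C eC] := f_onto le_vw (fun _ _ => id).
rewrite eB {1}eC; apply/f_sub/subsetP => s _; apply: contraT => sB.
(* If [s] were missing from [B], some cover [c] of [v] would lie below both [f [set s]] and [w'].
   Its set [X] would be contained in [[set s]] and in [B], hence empty, forcing [c = v]. *)
have neq_v : v <> f [set s].
  rewrite -f_bottom => e; have /f_sub : inv_sub (f [set s]) (f set0) by rewrite e.
  by rewrite subset0 -cards_eq0 cards1.
have [vs sw] := f_between [set s].
have [i [j [ji lt_ij s_ij]]] := ascent_below vs neq_v.
have w_ij := sw _ _ s_ij.
pose c := (tperm i j * v)%g.
have vc : inv_sub v c by move=> x y vxy; rewrite inv_swap // vxy.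
have [X eX] := f_onto vc (swap_inv_sub ji lt_ij le_vw w_ij).
have Xs : X \subset [set s] by apply/f_sub; rewrite -eX; apply: swap_inv_sub.
have XB : X \subset B.
  by apply/f_sub; rewrite -eX -eB; apply: swap_inv_sub => //; apply: descent_tie_perm.
have X0 : X = set0.
  apply/eqP; rewrite -subset0; apply/subsetP => t tX.
  have /set1P ets := subsetP Xs t tX.
  by rewrite -ets (subsetP XB) in sB.
have : inv c (v i) (v j) by rewrite inv_swap // !eqxx orbT.
rewrite eX X0 f_bottom inv_perm; lia.
Qed.

End Structure.

Lemma boolean_interval_tie k (I : {set 'S_n}) : boolean_interval k I ->
  exists r : n.-tuple 'I_n,
    [/\ is_ranking (tnth r), ties_at_most_2 (tnth r) & I = tie_interval (tnth r)].
Proof.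
move=> /existsP[v /existsP[w /and3P[/weak_leP vw /eqP-> /existsP[f /and3P[_ /eqP f_image]]]]].
move=> /forallP f_order'.
have f_order (A B : {set 'I_k}) : (A \subset B) = weak_le (f A) (f B).
  by apply/eqP; apply: (forallP (f_order' A)).
exists (@pos_rank v w); split.
- exact: pos_rank_ranking vw f_image f_order.
- exact: pos_rank_ties.
- by rewrite /tie_interval (tie_perm_bottom vw f_image f_order) (tie_perm_top vw f_image f_order).
Qed.

Lemma card_boolean_interval k (I : {set 'S_n}) : boolean_interval k I -> #|I| = 2 ^ k.
Proof.
move=> /existsP[v /existsP[w /and3P[_ _ /existsP[f /and3P[/injectiveP f_inj /eqP<- _]]]]].
by rewrite card_imset // -cardsT -powersetT card_powerset cardsT card_ord.
Qed.

End BooleanIntervals.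

(** * Matching the rank of the interval with the number of ranks, and the bijection *)

Lemma num_ranksE n (r : n.-tuple 'I_n) : num_ranks r = #|[set tnth r x | x in 'I_n]|.
Proof.
rewrite /num_ranks -(card_uniqP (undup_uniq r)); apply: eq_card => c.
rewrite mem_undup; apply/tnthP/imsetP => [[x ->]|[x _ ->]]; by exists x.
Qed.

(** A Boolean interval of rank [k] has [2 ^ k] elements, so its rank is unique and here equals the
    number of tied ranks. *)
Lemma tie_interval_rank n k (r : n.-tuple 'I_n) : ties_at_most_2 (tnth r) ->
  boolean_interval k (tie_interval (tnth r)) = (num_ranks r + k == n).
Proof.
move=> le2; have card_ranks := card_tied_ranks le2; have bool_r := boolean_tie_interval le2.
rewrite num_ranksE -[X in _ == X]card_ranks eqn_add2l.
apply/idP/eqP => [bool_k|->//]; apply/eqP; rewrite -(eqn_exp2l _ _ (ltnSn 1)).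
by rewrite -(card_boolean_interval bool_k) (card_boolean_interval bool_r).
Qed.

Theorem theorem1p2 (n k : nat) (hn : 1 <= n) :
  exists f : unit_fubini_with n k -> boolean_intervals n k, bijective f.
Proof.
have F_ok (r : unit_fubini_with n k) : boolean_interval k (tie_interval (tnth (val r))).
  by case: r => r /= /andP[/unit_fubiniP[_ le2]]; rewrite tie_interval_rank.
pose F (r : unit_fubini_with n k) : boolean_intervals n k :=
    exist (boolean_interval k) (tie_interval (tnth (val r))) (F_ok r).
have F_inj : injective F.
  move=> r r' /(congr1 val) /= e; apply: val_inj; apply: eq_from_tnth.
  have [/unit_fubiniP[rk _] _] := andP (valP r); have [/unit_fubiniP[rk' _] _] := andP (valP r').
  exact: tie_interval_inj e.
have F_onto (I : boolean_intervals n k) :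
    exists r : {r : n.-tuple 'I_n | unit_fubini_ranking r && (num_ranks r + k == n)},
      tie_interval (tnth (val r)) == val I.
  case: I => I bI; have [r [rk_r le2_r eI]] := boolean_interval_tie bI.
  have unit_r : unit_fubini_ranking r && (num_ranks r + k == n).
    by rewrite -tie_interval_rank // -eI bI andbT; apply/unit_fubiniP.
  by exists (exist _ r unit_r); rewrite /= eI.
(* A chosen preimage gives a right inverse of [F]; injectivity makes it a left inverse too. *)
exists F; exists (fun I => xchoose (F_onto I)) => [r|I].
  by apply: F_inj; apply: val_inj; apply/eqP; apply: (xchooseP (F_onto (F r))).
by apply: val_inj; apply/eqP; apply: (xchooseP (F_onto I)).
Qed.
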